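(* Let $A=(a_{uv})\in\mathbb{C}^{n\times n}$ and let $G=G(A)$ be its digraph, with blocks $B_1,\dots,B_k$ and set of cut-vertices $C$, $|C|=m$. For each cut-vertex $w$ let $d_w$ be its cut-index in $G$ and $\alpha_w=a_{ww}$. For $R\subseteq C$ put $L(R)=\prod_{w\in R}(\lambda-\alpha_w)(d_w-1)$ (so $L(\emptyset)=1$), and let $S(R)$ be the sum, over all $\mathcal{B}$-partitions $(U_1,\dots,U_k)$ of $G\setminus R$, of the $\phi$-summand $\prod_{i=1}^k\phi(G[U_i])$. Then $$\phi(G)=\sum_{q=0}^{m}\ \sum_{R\subseteq C,\ |R|=q} L(R)\,S(R).$$
   Context: For $A\in\mathbb{C}^{n\times n}$, the digraph $G(A)$ has vertex set $\{1,\dots,n\}$ and an edge $(u,v)$ whenever $a_{uv}\neq 0$ (a loop at $u$ if $a_{uu}\ne0$). Paths ignore edge directions; connected, components and cut-vertex (a vertex whose removal increases the number of components) are defined accordingly. A block is a maximal connected subdigraph having no cut-vertex; the cut-index of a cut-vertex is the number of blocks containing it. For $U\subseteq V(G)$, $G[U]$ is the induced subdigraph with matrix the principal submatrix $A[U]$, and $\phi(G[U])=\det(A[U]-\lambda I)$, with $\phi=1$ for $U=\emptyset$. For $R\subseteq C$, a $\mathcal{B}$-partition of $G\setminus R$ (the induced subdigraph on $V(G)\setminus R$) is a $k$-tuple $(U_1,\dots,U_k)$ of pairwise disjoint (possibly empty) sets with $\bigcup_i U_i=V(G)\setminus R$ and $U_i\subseteq V(B_i)\setminus R$ for each $i$.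 *)

(* Defs.v *)
From HB Require Import structures.
From mathcomp Require Import all_boot all_order all_algebra.
From mathcomp Require Import reals complex.

Set Implicit Arguments.
Unset Strict Implicit.
Unset Printing Implicit Defensive.

Import GRing.Theory.
Local Open Scope ring_scope.

(* Digraphs (loops allowed) whose vertices form a subset of a finite type T. *)
Section Digraph.
Variable T : finType.

Definition edges_wf (VE : {set T} * {set T * T}) : bool :=
  VE.2 \subset setX VE.1 VE.1.

Record digraph := Digraph {
  digraph_val : {set T} * {set T * T};
  _ : edges_wf digraph_val }.

HB.instance Definition _ := [isSub for digraph_val].
HB.instance Definition _ := [Finite of digraph by <:].

Definition verts (H : digraph) : {set T} := (val H).1.
Definition edges (H : digraph) : {set T * T} := (val H).2.

Definition subdigraph (H K : digraph) : bool :=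
  (verts H \subset verts K) && (edges H \subset edges K).

Lemma induced_wf (H : digraph) (U : {set T}) :
  edges_wf (verts H :&: U, edges H :&: setX U U).
Proof.
apply/subsetP => -[u v]; rewrite !inE /= => /andP[uvH /andP[-> ->]].
by have /subsetP/(_ _ uvH) := valP H; rewrite !inE !andbT.
Qed.

Definition induced (H : digraph) (U : {set T}) : digraph :=
  Digraph (induced_wf H U).

Definition remove_vertex (H : digraph) (v : T) : digraph :=
  induced H (verts H :\ v).

(* Paths ignore edge directions, hence the symmetrised edge relation. *)
Definition adj (H : digraph) : rel T :=
  fun u v => ((u, v) \in edges H) || ((v, u) \in edges H).

(* verts H is closed under adj H, as n_comp requires. *)
Definition num_components (H : digraph) : nat := n_comp (adj H) (verts H).

Definition connected (H : digraph) : bool :=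
  (verts H != set0) &&
  [forall u in verts H, forall v in verts H, connect (adj H) u v].

Definition cut_vertex (H : digraph) (v : T) : bool :=
  (v \in verts H) &&
  (num_components H < num_components (remove_vertex H v))%N.

Definition cut_vertices (H : digraph) : {set T} := [set v | cut_vertex H v].

Definition nonseparable (H : digraph) : bool :=
  connected H && [forall v, ~~ cut_vertex H v].

Definition is_block (G H : digraph) : bool :=
  [&& subdigraph H G, nonseparable H &
    [forall K : digraph,
      [&& subdigraph K G, nonseparable K & subdigraph H K] ==> (K == H)]].

Definition blocks (G : digraph) : {set digraph} := [set H | is_block G H].

Definition cut_index (G : digraph) (w : T) : nat :=
  #|[set H in blocks G | w \in verts H]|.

Definition B_partition (k : nat) (B : 'I_k -> digraph) (G : digraph)
    (R : {set T}) (U : {ffun 'I_k -> {set T}}) : bool :=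
  [&& [forall i, forall j, (i != j) ==> [disjoint U i & U j]],
      \bigcup_i U i == verts G :\: R &
      [forall i, U i \subset verts (B i) :\: R]].

End Digraph.

Section Matrix.
Variables (F : fieldType) (n : nat) (A : 'M[F]_n).

Lemma digraph_of_wf :
  edges_wf ([set: 'I_n], [set uv : 'I_n * 'I_n | A uv.1 uv.2 != 0]).
Proof. by apply/subsetP => uv _; rewrite !inE. Qed.

Definition digraph_of : digraph 'I_n := Digraph digraph_of_wf.

Definition principal_submx (U : {set 'I_n}) : 'M[F]_#|U| :=
  mxsub (@enum_val _ (mem U)) (@enum_val _ (mem U)) A.

End Matrix.

(* det (M - lambda I), with lambda the polynomial indeterminate; this is
   (-1)^m times the library's char_poly, and equals 1 when m = 0. *)
Definition phi (F : fieldType) (m : nat) (M : 'M[F]_m) : {poly F} :=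
  \det (map_mx polyC M - 'X%:M).

Definition L_term (F : fieldType) (n : nat) (A : 'M[F]_n) (R : {set 'I_n}) :
    {poly F} :=
  \prod_(w in R)
    (('X - (A w w)%:P) * ((cut_index (digraph_of A) w)%:R - 1)).

Definition S_term (F : fieldType) (n : nat) (A : 'M[F]_n) (k : nat)
    (B : 'I_k -> digraph 'I_n) (R : {set 'I_n}) : {poly F} :=
  \sum_(U : {ffun 'I_k -> {set 'I_n}} | B_partition B (digraph_of A) R U)
    \prod_(i < k) phi (principal_submx A (U i)).

(* Main.v *)
(** Expand every determinant over permutations. A nontrivial cycle of a
    permutation with nonzero weight is a cycle of G, hence lies in exactly one
    block, whereas a fixed point v may be assigned to any of the d_v blocks
    through it, or, if v is a cut-vertex, put in R with weight
    (λ - α_v)(d_v - 1) = (α_v - λ)(1 - d_v). Since d_v + (1 - d_v) = 1, and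
    d_v = 1 off the cut-vertices, the weights add up to the Leibniz formula
    for φ(G). *)

Require Import Defs.
From mathcomp Require Import all_boot all_order all_fingroup all_algebra.
From mathcomp Require Import reals complex.

Set Implicit Arguments.
Unset Strict Implicit.
Unset Printing Implicit Defensive.

Import GRing.Theory.

(** * Vertex sets that stay connected when any one vertex is deleted *)

Section Nonseparable.
Variables (T : finType) (e : rel T).
Hypothesis e_sym : symmetric e.
Implicit Types (D S : {set T}) (u v x y : T).

Definition restrict S : rel T := [rel x y | [&& x \in S, y \in S & e x y]].

(** Nonseparability of the subgraph induced on [S], expressed by connectivity instead of component
    counts, which makes unions easy to treat. For [u] outside [S] the last clause repeats the
    second. *)
Definition nonsep S : Prop :=
  [/\ S != set0, {in S &, forall x y, connect (restrict S) x y}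
    & forall u, {in S :\ u &, forall x y, connect (restrict (S :\ u)) x y}].

Lemma restrict_sym S : symmetric (restrict S).
Proof. by move=> x y; rewrite /restrict /= e_sym andbCA. Qed.

Lemma connect_restrict_sym S x y :
  connect (restrict S) x y = connect (restrict S) y x.
Proof. exact/sym_connect_sym/restrict_sym. Qed.

Lemma connect_restrictS S S' x y :
  S \subset S' -> connect (restrict S) x y -> connect (restrict S') x y.
Proof.
move=> /subsetP sSS'; apply: connect_sub => {x y} x y /and3P[xS yS exy].
by apply: connect1; rewrite /restrict /= !sSS'.
Qed.

Lemma connect_setU S1 S2 c :
    {in S1 &, forall x y, connect (restrict S1) x y} ->
    {in S2 &, forall x y, connect (restrict S2) x y} ->
    c \in S1 -> c \in S2 ->
  {in S1 :|: S2 &, forall x y, connect (restrict (S1 :|: S2)) x y}.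
Proof.
move=> con1 con2 c1 c2.
suff toc x : x \in S1 :|: S2 -> connect (restrict (S1 :|: S2)) x c.
  move=> x y xS yS; apply: connect_trans (toc x xS) _.
  by rewrite connect_restrict_sym toc.
case/setUP=> xS.
  by apply: connect_restrictS (con1 _ _ xS c1); apply: subsetUl.
by apply: connect_restrictS (con2 _ _ xS c2); apply: subsetUr.
Qed.

Lemma nonsep1 v : nonsep [set v].
Proof.
split=> [|x y|u x y]; first by apply/set0Pn; exists v; rewrite set11.
  by move=> /set1P-> /set1P->.
by move=> /setD1P[_ /set1P->] /setD1P[_ /set1P->].
Qed.

(** Whichever vertex is deleted, one of [a] and [b] survives and still joins the two sets. *)
Lemma nonsepU S1 S2 a b :
    nonsep S1 -> nonsep S2 -> a != b ->
    a \in S1 -> a \in S2 -> b \in S1 -> b \in S2 ->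
  nonsep (S1 :|: S2).
Proof.
move=> [_ con1 sep1] [_ con2 sep2] neq_ab a1 a2 b1 b2; split.
- by apply/set0Pn; exists a; rewrite inE a1.
- exact: connect_setU con1 con2 a1 a2.
move=> u; rewrite setDUl.
have [c [cu c1 c2]] : exists c, [/\ c != u, c \in S1 & c \in S2].
  by case: (eqVneq a u) => [<-|au]; [exists b; rewrite eq_sym | exists a].
by apply: (connect_setU (sep1 u) (sep2 u) (c := c)); rewrite !inE cu.
Qed.

Lemma path_connect_restrict S x p :
  path e x p -> {subset x :: p <= S} ->
  {in x :: p, forall y, connect (restrict S) x y}.
Proof.
elim: p x => [|z p IHp] x /= => [_ _ y|/andP[exz ezp] sS y].
  by rewrite inE => /eqP->.
rewrite inE => /predU1P[->//|yp].
apply: (connect_trans (y := z)).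
  by apply: connect1; rewrite /restrict /= exz !sS // !inE eqxx ?orbT.
by apply: IHp => // t tp; apply: sS; rewrite inE tp orbT.
Qed.

(* A path avoiding v from S1 to S2 closes the ear: deleting v leaves the path
   to join S1 and S2, and deleting any other vertex u leaves v to join them,
   while each remaining vertex of the path keeps one of its two sides. *)
Lemma nonsep_ear D S1 S2 v x1 x2 :
    S1 \subset D -> S2 \subset D ->
    nonsep S1 -> nonsep S2 -> v \in S1 -> v \in S2 ->
    x1 \in S1 -> x2 \in S2 -> x1 != v -> x2 != v ->
    connect (restrict (D :\ v)) x1 x2 ->
  exists S, [/\ S \subset D, S1 \subset S, S2 \subset S & nonsep S].
Proof.
move=> sS1D sS2D [_ con1 sep1] [_ con2 sep2] v1 v2 x1S x2S x1v x2v
  /connectP[p0 ep0 Dx2].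
(* The path is made simple, so that a deleted vertex met before some [y] on it cannot occur again
   after [y]. *)
case/shortenP: ep0 Dx2 => p ep Up _ Dx2.
have pv : {subset x1 :: p <= D :\ v}.
  move=> y; rewrite inE => /predU1P[->|];
    first by rewrite !inE x1v (subsetP sS1D).
  elim: p (x1) ep {Up Dx2} => //= z p IHp t /andP[/and3P[_ zv _] ezp].
  by rewrite inE => /predU1P[->//|yp]; apply: IHp ezp yp.
have {}ep : path e x1 p by apply: sub_path ep => y z /and3P[].
pose P := [set y in x1 :: p].
have x1P : x1 \in P by rewrite !inE eqxx.
have x2P : x2 \in P by rewrite inE Dx2 mem_last.
have conP S : P \subset S -> {in P &, forall x y, connect (restrict S) x y}.
  move=> /subsetP sPS.
  suff fromx1 y : y \in P -> connect (restrict S) x1 y.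
    move=> x y xP yP; apply: (connect_trans (y := x1)); last exact: fromx1.
    by rewrite connect_restrict_sym fromx1.
  move=> yP; apply: (path_connect_restrict ep); last by rewrite inE in yP.
  by move=> z zP; apply: sPS; rewrite inE.
exists (S1 :|: S2 :|: P); split.
- rewrite !subUset sS1D sS2D; apply/subsetP => y; rewrite inE => /pv.
  by case/setD1P.
- by rewrite -setUA subsetUl.
- by rewrite (setUC S1) -setUA subsetUl.
split; first by apply/set0Pn; exists v; rewrite !inE v1.
  apply: (connect_setU (connect_setU con1 con2 v1 v2) (conP _ (subxx P)) _ x1P).
  by rewrite inE x1S.
move=> u.
have [->|uv] := eqVneq u v.
  have PDv : P :\ v = P.
    apply/setP => y; rewrite in_setD1 andb_idl // inE => /pv.
    by case/setD1P.
  rewrite setUAC !setDUl PDv; apply: (connect_setU (c := x2)).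
  - apply: (connect_setU (sep1 v) _ (c := x1)) x1P; first exact: conP.
    by rewrite !inE x1v.
  - exact: sep2.
  - by rewrite inE x2P orbT.
  - by rewrite !inE x2v.
set K := _ :\ u.
have sK S : S \subset S1 :|: S2 :|: P -> S :\ u \subset K by apply: setSD.
have v1u : v \in S1 :\ u by rewrite !inE eq_sym uv.
have v2u : v \in S2 :\ u by rewrite !inE eq_sym uv.
have from1 y : y \in S1 -> y != u -> connect (restrict K) v y.
  move=> y1 yu; apply: connect_restrictS (sep1 u _ _ v1u _).
    by apply: sK; rewrite -setUA subsetUl.
  by rewrite !inE yu.
have from2 y : y \in S2 -> y != u -> connect (restrict K) v y.
  move=> y2 yu; apply: connect_restrictS (sep2 u _ _ v2u _).
    by apply: sK; rewrite (setUC S1) -setUA subsetUl.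
  by rewrite !inE yu.
suff fromv y : y \in K -> connect (restrict K) v y.
  move=> x y xK yK; apply: (connect_trans (y := v)); last exact: fromv.
  by rewrite connect_restrict_sym fromv.
case/setD1P=> yu /setUP[/setUP[y1|y2]|]; [exact: from1 | exact: from2 |].
rewrite inE => yp.
have inK z : z \in x1 :: p -> z != u -> z \in K.
  by move=> zp zu; rewrite in_setD1 zu inE [z \in P]inE zp orbT.
case/splitPl: yp ep Up Dx2 inK => p1 p2 Dy.
rewrite cat_path Dy last_cat Dy -cat_cons cat_uniq.
move=> /andP[ep1 ep2] /and3P[_ nop12 _] Dx2 inK.
have y1 : y \in x1 :: p1 by rewrite -Dy mem_last.
have [u1|u1] := boolP (u \in x1 :: p1); last first.
  have neqp1 z : z \in x1 :: p1 -> z != u by apply: contraTneq => ->.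
  apply: (connect_trans (from1 _ x1S _)); first by rewrite neqp1 ?mem_head.
  apply: (path_connect_restrict ep1) => // z zp1.
  by rewrite inK ?neqp1 // mem_cat zp1.
have neqp2 z : z \in y :: p2 -> z != u.
  rewrite inE => /predU1P[->//|zp2].
  by apply: contraNneq nop12 => zu; apply/hasP; exists u; rewrite // -zu.
have x2p2 : x2 \in y :: p2 by rewrite Dx2 mem_last.
apply: (connect_trans (from2 _ x2S (neqp2 _ x2p2))).
rewrite connect_restrict_sym; apply: (path_connect_restrict ep2) => // z zp2.
rewrite inK ?neqp2 // mem_cat.
by rewrite inE in zp2; case/predU1P: zp2 => [->|->]; rewrite ?y1 ?orbT.
Qed.

(** Deleting [w] from its cycle leaves the path [s w], [s (s w)], and so on, which is connected. A
    fixed point needs no edge, its orbit being a single vertex. *)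
Lemma nonsep_porbit (s : {perm T}) v :
  (forall x, s x != x -> e x (s x)) -> nonsep (porbit s v).
Proof.
move=> es.
have stepS S x y : x \in S -> y \in S -> (y = s x) -> connect (restrict S) x y.
  move=> xS yS Dy; have [->//|yx] := eqVneq y x.
  by apply: connect1; rewrite /restrict /= xS yS Dy es // -Dy.
have inO u i : u \in porbit s v -> (s ^+ i)%g u \in porbit s v.
  by rewrite -!eq_porbit_mem porbit_perm.
have conO : {in porbit s v &, forall x y, connect (restrict (porbit s v)) x y}.
  move=> x y xO; rewrite -eq_porbit_mem in xO; rewrite -(eqP xO).
  case/porbitP=> i ->; elim: i => [|i IHi]; first by rewrite expg0 perm1.
  apply: (connect_trans IHi).
  apply: stepS; last by rewrite expgSr permM.
    by rewrite (eqP xO) inO // -eq_porbit_mem.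
  by rewrite (eqP xO) inO // -eq_porbit_mem.
split=> // [|w x y]; first by apply/set0Pn; exists v; rewrite porbit_id.
have [wO|wO] := boolP (w \in porbit s v); last first.
  have -> : porbit s v :\ w = porbit s v.
    by apply/setDidPl; rewrite disjoint_sym disjoints1.
  exact: conO.
suff froms z : z \in porbit s v :\ w ->
    connect (restrict (porbit s v :\ w)) (s w) z.
  move=> xO yO; apply: (connect_trans (y := s w)); last exact: froms.
  by rewrite connect_restrict_sym froms.
case/setD1P=> zw zO.
have /porbitP[i Dz] : z \in porbit s w
  by rewrite -eq_porbit_mem in wO; rewrite (eqP wO).
move: zw; rewrite {z zO}Dz; elim: i => [|i IHi];
  first by rewrite expg0 perm1 eqxx.
rewrite expgSr permM; set z := (s ^+ i)%g w in IHi * => szw.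
(* When [z] is [w], at the first step or after a full turn, the next vertex is the starting point
   [s w] itself. *)
have [->//|zw] := eqVneq z w.
apply: (connect_trans (IHi zw)); apply: stepS => //;
  first by rewrite !inE zw inO.
by rewrite !inE szw -permM -expgSr inO.
Qed.

End Nonseparable.

(** * Components, cut-vertices and nonseparable subdigraphs *)

Section Blocks.
Variable T : finType.
Implicit Types (G H K : digraph T) (S : {set T}) (u v x y : T).

Lemma adj_sym H : symmetric (adj H).
Proof. by move=> x y; rewrite /adj orbC. Qed.

Lemma adj_connect_sym H : connect_sym (adj H).
Proof. exact/sym_connect_sym/adj_sym. Qed.

Lemma edge_verts H x y :
  (x, y) \in edges H -> (x \in verts H) && (y \in verts H).
Proof. by move=> xy; have /subsetP/(_ _ xy) := valP H; rewrite inE. Qed.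

Lemma adj_verts H x y : adj H x y -> (x \in verts H) && (y \in verts H).
Proof. by case/orP=> /edge_verts //; rewrite andbC. Qed.

Lemma verts_closed H : closed (adj H) (verts H).
Proof.
apply: intro_closed; first exact: adj_connect_sym.
by move=> x y /adj_verts/andP[].
Qed.

Lemma connect_adjS K H x y :
  subdigraph K H -> connect (adj K) x y -> connect (adj H) x y.
Proof.
case/andP=> _ /subsetP sE; apply: connect_sub => {x y} x y xy.
by apply: connect1; case/orP: xy => /sE xy; rewrite /adj xy ?orbT.
Qed.

(* Each component of H meets K, so the components of K map onto those of H;
   if K has no more components than H, this map is injective. *)
Lemma connect_num_components K H x y :
    subdigraph K H ->
    {in verts H, forall z, exists2 t, t \in verts K & connect (adj H) z t} ->
    num_components K <= num_components H ->
    x \in verts K -> y \in verts K -> connect (adj H) x y ->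
  connect (adj K) x y.
Proof.
move=> sKH meetK leKH xK yK cxy.
pose rts (L : digraph T) := [set z in verts L | roots (adj L) z].
have card_rts (L : digraph T) : #|rts L| = num_components L.
  by apply: eq_card => z; rewrite !inE andbC.
have root_rts (L : digraph T) (z : T) :
    z \in verts L -> fingraph.root (adj L) z \in rts L.
  move=> zL; rewrite inE roots_root ?andbT; last exact: adj_connect_sym.
  by rewrite -(closed_connect (@verts_closed L) (connect_root _ z)).
have rootKH z : fingraph.root (adj H) (fingraph.root (adj K) z) =
    fingraph.root (adj H) z.
  apply/esym/fingraph.rootP; first exact: adj_connect_sym.
  exact: connect_adjS sKH (connect_root _ z).
have onto : rts H \subset fingraph.root (adj H) @: rts K.
  apply/subsetP=> r; rewrite inE => /andP[/meetK[t tK crt] /eqP Dr].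
  apply/imsetP; exists (fingraph.root (adj K) t); first exact: root_rts.
  by rewrite rootKH -{1}Dr; apply/fingraph.rootP => //; apply: adj_connect_sym.
have injr : {in rts K &, injective (fingraph.root (adj H))}.
  apply/imset_injP; rewrite eqn_leq leq_imset_card /= card_rts.
  by rewrite (leq_trans leKH) // -card_rts subset_leq_card.
apply/(fingraph.rootP (@adj_connect_sym K))/injr; try exact: root_rts.
by rewrite !rootKH; apply/fingraph.rootP => //; apply: adj_connect_sym.
Qed.

Lemma subdigraph_refl H : subdigraph H H.
Proof. by rewrite /subdigraph !subxx. Qed.

Lemma subdigraph_trans K H G :
  subdigraph K H -> subdigraph H G -> subdigraph K G.
Proof.
move=> /andP[vKH eKH] /andP[vHG eHG].
by rewrite /subdigraph (subset_trans vKH) ?(subset_trans eKH).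
Qed.

Lemma subdigraph_card H K : subdigraph H K ->
  #|verts K| + #|edges K| <= #|verts H| + #|edges H| -> H = K.
Proof.
move=> /andP[vHK eHK] le; apply/val_inj/injective_projections => /=.
  apply/eqP; rewrite eqEcard vHK /= -(leq_add2r #|edges H|).
  by apply: leq_trans le; rewrite leq_add2l subset_leq_card.
apply/eqP; rewrite eqEcard eHK /= -(leq_add2l #|verts H|).
by apply: leq_trans le; rewrite leq_add2r subset_leq_card.
Qed.

Lemma subdigraph_induced G S : subdigraph (induced G S) G.
Proof. by rewrite /subdigraph !subsetIl. Qed.

Lemma remove_vertex_sub H v : subdigraph (remove_vertex H v) H.
Proof. exact: subdigraph_induced. Qed.

Lemma verts_induced G S : S \subset verts G -> verts (induced G S) = S.
Proof. by move=> /setIidPr. Qed.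

Lemma verts_remove H v : verts (remove_vertex H v) = verts H :\ v.
Proof. by rewrite verts_induced ?subsetDl. Qed.

Lemma adj_induced G S : adj (induced G S) =2 restrict (adj G) S.
Proof.
move=> x y; rewrite /adj /restrict /= !inE /=.
by case: (x \in S); case: (y \in S); rewrite ?andbT ?andbF.
Qed.

Lemma adj_remove_vertex H v :
  adj (remove_vertex H v) =2 restrict (adj H) (verts H :\ v).
Proof. exact: adj_induced. Qed.

(** Deleting [v] does not increase the number of components, so [connect_num_components] applies;
    [x] shows that [v] lies in [H] and that its component meets the remaining vertices. *)
Lemma noncut_connect H v x y :
    ~~ cut_vertex H v -> x \in verts H :\ v -> y \in verts H :\ v ->
    connect (adj H) v x -> connect (adj H) x y ->
  connect (restrict (adj H) (verts H :\ v)) x y.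
Proof.
move=> ncut xH yH cvx cxy; rewrite -(eq_connect (@adj_remove_vertex H v)).
have xv : x != v by case/setD1P: xH.
have cxv : connect (adj H) x v by rewrite adj_connect_sym.
apply: connect_num_components cxy; rewrite ?verts_remove //.
- exact: remove_vertex_sub.
- move=> z zH; have [->|zv] := eqVneq z v; first by exists x.
  by exists z; rewrite // !inE zv.
rewrite leqNgt; apply: contra ncut; rewrite /cut_vertex => ->; rewrite andbT.
have [//|vH] := boolP (v \in verts H).
by have := closed_connect (@verts_closed H) cvx;
  rewrite (negPf vH) (subsetP (subsetDl _ [set v])).
Qed.

(** [H] need not be induced, but its edges are edges of [G], so every connection within [H], or
    within [H] minus a vertex, persists in [G] restricted to the same vertices. *)
Lemma nonseparable_nonsep G H :
  subdigraph H G -> nonseparable H -> nonsep (adj G) (verts H).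
Proof.
move=> sHG /andP[/andP[H0 /forall_inP conH] /forallP ncut].
have sadj x y : adj H x y -> adj G x y.
  by case/andP: sHG => _ /subsetP sE; case/orP=> /sE xy; rewrite /adj xy ?orbT.
have {}conH x y : x \in verts H -> y \in verts H -> connect (adj H) x y.
  by move=> xH yH; have /forall_inP/(_ _ yH) := conH _ xH.
split=> // [x y xH yH|u x y xH yH].
  apply: connect_sub (conH _ _ xH yH) => z t zt; apply: connect1.
  by have /andP[zH tH] := adj_verts zt; rewrite /restrict /= zH tH sadj.
have [uH|uH] := boolP (u \in verts H).
  have [[_ xH'] [_ yH']] := (setD1P xH, setD1P yH).
  apply: connect_sub (noncut_connect (ncut u) xH yH (conH _ _ uH xH')
    (conH _ _ xH' yH')).
  by move=> z t /and3P[zH tH zt]; apply: connect1;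
    rewrite /restrict /= zH tH sadj.
have -> : verts H :\ u = verts H.
  by apply/setDidPl; rewrite disjoint_sym disjoints1.
have [[_ xH'] [_ yH']] := (setD1P xH, setD1P yH).
apply: connect_sub (conH _ _ xH' yH') => z t zt; apply: connect1.
by have /andP[zH tH] := adj_verts zt; rewrite /restrict /= zH tH sadj.
Qed.

Lemma nonsep_nonseparable G S :
  S \subset verts G -> nonsep (adj G) S -> nonseparable (induced G S).
Proof.
move=> sSG [S0 conS sepS].
have VS : verts (induced G S) = S by exact: verts_induced.
have symS := @adj_connect_sym (induced G S).
apply/andP; split.
  rewrite /connected VS S0 /=; apply/forall_inP=> x xS; apply/forall_inP=> y yS.
  by rewrite (eq_connect (@adj_induced G S)) conS.
apply/forallP=> v; rewrite /cut_vertex; apply/nandP; right; rewrite -leqNgt.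
(* At most one component is left after deleting [v], and there is at least one before. *)
apply: (@leq_trans 1).
  have inP z : z \in verts (remove_vertex (induced G S) v) -> z \in S :\ v.
    by rewrite verts_remove VS.
  apply/card_le1_eqP => x y /andP[/eqP Dx /inP xS] /andP[/eqP Dy /inP yS].
  rewrite -Dx -Dy; apply/fingraph.rootP; first exact: adj_connect_sym.
  rewrite (eq_connect (@adj_remove_vertex _ v)) VS.
  apply: connect_sub (sepS v _ _ yS xS) => z t /and3P[zS tS zt].
  apply: connect1; rewrite /restrict /= zS tS adj_induced /restrict /= zt.
  by case/setD1P: zS => _ ->; case/setD1P: tS => _ ->.
case/set0Pn: S0 => x xS; apply/card_gt0P; exists (fingraph.root (adj (induced
  G S)) x).
apply/andP; split; first exact: roots_root.
suff : fingraph.root (adj (induced G S)) x \in verts (induced G S) by [].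
by rewrite -(closed_connect (@verts_closed _) (connect_root _ x)) VS.
Qed.

(** * Existence and uniqueness of blocks through given vertices *)

Lemma nonseparable_sub_block G K :
  subdigraph K G -> nonseparable K ->
  exists2 H, H \in blocks G & subdigraph K H.
Proof.
move=> sKG nsK.
pose P L := [&& subdigraph L G, nonseparable L & subdigraph K L].
have PK : P K by rewrite /P sKG nsK subdigraph_refl.
(* A nonseparable subdigraph above [K] with the most vertices and edges in total is maximal for
   inclusion, hence a block. *)
case: (arg_maxnP (fun L => #|verts L| + #|edges L|) PK) => H /and3P[sHG nsH
  sKH] maxH.
exists H => //; rewrite inE; apply/and3P; split=> //.
apply/forallP=> L; apply/implyP=> /and3P[sLG nsL sHL]; rewrite eq_sym.
apply/eqP/subdigraph_card => //; apply: maxH.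
by rewrite /P sLG nsL (subdigraph_trans sKH).
Qed.

Lemma block_maximal G H K :
  H \in blocks G -> subdigraph K G -> nonseparable K -> subdigraph H K -> K = H.
Proof.
by rewrite inE => /and3P[_ _ /forallP/(_ K)/implyP maxH] sK nsK sHK;
  apply/eqP/maxH/and3P.
Qed.

Lemma block_nonsep G H : H \in blocks G -> nonsep (adj G) (verts H).
Proof. by rewrite inE => /and3P[sHG nsH _]; apply: nonseparable_nonsep. Qed.

Lemma block_sub_induced G H S :
  H \in blocks G -> verts H \subset S -> subdigraph H (induced G S).
Proof.
rewrite inE => /and3P[/andP[vHG eHG] _ _] /subsetP sHS; apply/andP; split.
  by rewrite subsetI vHG; apply/subsetP.
rewrite subsetI eHG; apply/subsetP => -[x y] xyH; rewrite inE /=.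
by case/andP: (edge_verts xyH) => /sHS-> /sHS.
Qed.

(** Both blocks are subdigraphs of the nonseparable [induced G S], so by maximality both equal
    it. *)
Lemma block_eq_of_nonsep G H1 H2 S :
    H1 \in blocks G -> H2 \in blocks G -> S \subset verts G ->
    nonsep (adj G) S -> verts H1 \subset S -> verts H2 \subset S ->
  H1 = H2.
Proof.
move=> bH1 bH2 sSG /(nonsep_nonseparable sSG) nsS s1 s2.
have sG := subdigraph_induced G S.
have E1 := block_maximal bH1 sG nsS (block_sub_induced bH1 s1).
by have E2 := block_maximal bH2 sG nsS (block_sub_induced bH2 s2);
  rewrite -E1 -E2.
Qed.

Lemma block_verts_sub G H : H \in blocks G -> verts H \subset verts G.
Proof. by rewrite inE => /and3P[/andP[]]. Qed.

Lemma block_eq_of_share2 G H1 H2 x y :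
    H1 \in blocks G -> H2 \in blocks G -> x != y ->
    x \in verts H1 -> x \in verts H2 -> y \in verts H1 -> y \in verts H2 ->
  H1 = H2.
Proof.
move=> bH1 bH2 xy x1 x2 y1 y2.
apply: (@block_eq_of_nonsep G _ _ (verts H1 :|: verts H2)) => //.
- by rewrite subUset !block_verts_sub.
- exact: (nonsepU (@adj_sym G) (block_nonsep bH1) (block_nonsep bH2) xy).
- exact: subsetUl.
- exact: subsetUr.
Qed.

Lemma nonsep_sub_block G S : S \subset verts G -> nonsep (adj G) S ->
  exists2 H, H \in blocks G & S \subset verts H.
Proof.
move=> sSG nsS.
have [H bH /andP[sSH _]] :=
  nonseparable_sub_block (subdigraph_induced G S) (nonsep_nonseparable sSG nsS).
by exists H => //; rewrite verts_induced in sSH.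
Qed.

(** Since [v] is no cut-vertex, further vertices [x1] and [x2] of the two blocks are joined by a
    path avoiding [v]; closing this ear yields one nonseparable set containing both blocks. *)
Lemma block_eq_of_noncut G H1 H2 v :
    ~~ cut_vertex G v -> H1 \in blocks G -> H2 \in blocks G ->
    v \in verts H1 -> v \in verts H2 ->
  H1 = H2.
Proof.
move=> ncut bH1 bH2 v1 v2.
have [ns1 ns2] := (block_nonsep bH1, block_nonsep bH2).
(* A block consisting of [v] alone lies inside the other block. *)
have [sub1|/subsetPn[x1 x1H /set1P/eqP x1v]] :=
  boolP (verts H1 \subset [set v]).
  apply: (block_eq_of_nonsep bH1 bH2 (block_verts_sub bH2) ns2) => //.
  by apply: subset_trans sub1 _; rewrite sub1set.
have [sub2|/subsetPn[x2 x2H /set1P/eqP x2v]] :=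
  boolP (verts H2 \subset [set v]).
  apply: (block_eq_of_nonsep bH1 bH2 (block_verts_sub bH1) ns1) => //.
  by apply: subset_trans sub2 _; rewrite sub1set.
have conG H x : H \in blocks G -> v \in verts H -> x \in verts H ->
    connect (adj G) v x.
  move=> bH vH xH; have [_ con _] := block_nonsep bH.
  by apply: connect_sub (con _ _ vH xH) => y z /and3P[_ _ yz]; apply: connect1.
have x1G := subsetP (block_verts_sub bH1) _ x1H.
have x2G := subsetP (block_verts_sub bH2) _ x2H.
have c12 : connect (restrict (adj G) (verts G :\ v)) x1 x2.
  apply: noncut_connect; rewrite ?inE ?x1v ?x2v //;
    first exact: conG bH1 v1 x1H.
  apply: (connect_trans (y := v)); last exact: conG bH2 v2 x2H.
  by rewrite adj_connect_sym; exact: conG bH1 v1 x1H.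
have [S [sSG s1 s2 nsS]] := nonsep_ear (@adj_sym G) (block_verts_sub bH1)
  (block_verts_sub bH2) ns1 ns2 v1 v2 x1H x2H x1v x2v c12.
exact: (block_eq_of_nonsep bH1 bH2 sSG nsS).
Qed.

(** The singleton of [v] is nonseparable, so some block contains [v] even if [v] is isolated;
    [block_eq_of_noncut] gives uniqueness. *)
Lemma cut_index_noncut G v :
  v \in verts G -> ~~ cut_vertex G v -> cut_index G v = 1%N.
Proof.
move=> vG ncut.
have [|H bH] := @nonsep_sub_block G [set v] _ (nonsep1 _ v);
  first by rewrite sub1set.
rewrite sub1set => vH; apply/eqP/cards1P; exists H; apply/setP=> K.
rewrite !inE -[is_block G K]in_set; apply/andP/eqP => [[bK vK]|->]; last first.
  by rewrite [_ \in _]bH.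
exact: block_eq_of_noncut ncut bK bH vK vH.
Qed.

End Blocks.

Local Open Scope ring_scope.

Lemma big_option (R : Type) (idx : R) (op : Monoid.com_law idx) (I : finType)
    (F : option I -> R) :
  \big[op/idx]_x F x = op (F None) (\big[op/idx]_i F (Some i)).
Proof.
rewrite (bigD1 None) //=; congr (op _ _).
by rewrite (reindex_omap Some id) //=;
  [apply: eq_bigl => i; rewrite eqxx | case].
Qed.

(** * Determinants split along the fibres of a map *)

Section DetFibers.
Variable R : comNzRingType.

(** Rows and columns undergo the same permutation, so the two signs cancel. *)
Lemma det_mxsub_bij m n (g : 'I_m -> 'I_n) (M : 'M[R]_n) :
  bijective g -> \det (mxsub g g M) = \det M.
Proof.
move=> bg; have eq_mn := bij_eq_card bg; rewrite !card_ord in eq_mn; subst m.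
pose s := perm (bij_inj bg).
have -> : mxsub g g M = row_perm s (col_perm s M).
  by apply/matrixP=> i j; rewrite !mxE !permE.
rewrite row_permE col_permE !det_mulmx !det_perm odd_permV.
by rewrite mulrCA -signr_addb addbb mulr1.
Qed.

(** Counterpart of [principal_submx] over a commutative ring, as the entries will be polynomials. *)
Definition submx_on n (M : 'M[R]_n) (S : {set 'I_n}) : 'M[R]_#|S| :=
  mxsub (@enum_val _ (mem S)) (@enum_val _ (mem S)) M.

(** Listing the indices of [S] first makes [M] block lower triangular. *)
Lemma det_submx_split n (M : 'M[R]_n) (S : {set 'I_n}) :
    (forall i j, i \in S -> j \notin S -> M i j = 0) ->
  \det M = \det (submx_on M S) * \det (submx_on M (~: S)).
Proof.
move=> M0.
pose g (i : 'I_(#|S| + #|~: S|)) : 'I_n :=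
  match split i with inl a => enum_val a | inr b => enum_val b end.
have bg : bijective g.
  apply: inj_card_bij; last by rewrite !card_ord cardsC card_ord.
  move=> i j; rewrite /g => eqg; apply: (can_inj (@splitK _ _)); move: eqg.
  case: (split i) (split j) => a [] b.
  - by move/enum_val_inj->.
  - by move=> ab; have := enum_valP b; rewrite -ab inE enum_valP.
  - by move=> ab; have := enum_valP a; rewrite ab inE enum_valP.
  - by move/enum_val_inj->.
rewrite -(det_mxsub_bij M bg) -(det_lblock _
  (mxsub (@enum_val _ (mem (~: S))) (@enum_val _ (mem S)) M)).
congr (\det _); apply/matrixP=> i j; rewrite !mxE /g.
case: (split i) => a; rewrite !mxE; case: (split j) => b; rewrite ?mxE //.
by rewrite M0 ?enum_valP //; have := enum_valP b; rewrite inE.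
Qed.

(** Padding with the identity brings principal minors of all sizes to size [n], so that their
    product becomes the determinant of a matrix product. *)
Lemma det_submx_on n (M : 'M[R]_n) (S : {set 'I_n}) :
  \det (submx_on M S) =
  \det (\matrix_(i, j) if (i \in S) && (j \in S) then M i j else (i == j)%:R).
Proof.
rewrite (@det_submx_split _ _ S) => [|i j iS jS]; last first.
  by rewrite mxE iS (negPf jS) /=; case: eqP jS => // <-; rewrite iS.
rewrite -[LHS]mulr1; congr (_ * _).
  by congr (\det _); apply/matrixP=> i j; rewrite !mxE !enum_valP.
transitivity (\det (1%:M : 'M[R]_#|~: S|)); first by rewrite det1.
congr (\det _); apply/matrixP=> i j.
rewrite !mxE (inj_eq enum_val_inj).
by have := enum_valP i; rewrite inE => /negPf->.
Qed.

Lemma det_fibers_seq n (J : eqType) (f : 'I_n -> J) (M : 'M[R]_n) (s : seq J) :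
    uniq s ->
  \prod_(c <- s) \det (submx_on M [set v | f v == c]) =
  \det (\matrix_(i, j)
          if (f i == f j) && (f i \in s) then M i j else (i == j)%:R).
Proof.
elim: s => [_|c s IHs /= /andP[cs /IHs{}IHs]].
  rewrite big_nil; transitivity (\det (1%:M : 'M[R]_n)); first by rewrite det1.
  by congr (\det _); apply/matrixP=> i j; rewrite !mxE andbF.
rewrite big_cons IHs det_submx_on -det_mulmx; congr (\det _).
apply/matrixP=> i j; rewrite !mxE inE.
(* Outside the fibre of [c] the rows of the first factor are identity rows; on that fibre those of
   the second factor are, because [c] is not in [s]. *)
have [fic|fic] := eqVneq (f i) c; last first.
  rewrite (bigD1 i) //= big1 ?addr0 => [|w wi].
    by rewrite !mxE inE (negPf fic) eqxx mul1r.
  by rewrite !mxE inE (negPf fic) eq_sym (negPf wi) mul0r.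
rewrite andbT (bigD1 j) //= big1 ?addr0 => [|w wj].
  rewrite !mxE !inE fic eqxx /= [c == _]eq_sym.
  have [->|fjc] := eqVneq (f j) c; first by rewrite (negPf cs) andbF eqxx mulr1.
  by rewrite (_ : i == j = false) ?mul0r //; apply: contraNF fjc => /eqP <-;
    apply/eqP.
rewrite !mxE !inE fic eqxx /=.
have [fwc|fwc] := eqVneq (f w) c.
  by rewrite fwc (negPf cs) andbF (negPf wj) mulr0.
by rewrite (_ : i == w = false) ?mul0r //; apply: contraNF fwc => /eqP <-;
  apply/eqP.
Qed.

Lemma det_fibers n (J : finType) (f : 'I_n -> J) (M : 'M[R]_n) :
  \prod_c \det (submx_on M [set v | f v == c]) =
  \det (\matrix_(i, j) if f i == f j then M i j else 0).
Proof.
rewrite det_fibers_seq ?index_enum_uniq //; congr (\det _).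
apply/matrixP=> i j; rewrite !mxE mem_index_enum andbT.
by case: eqVneq => // fij; rewrite (_ : i == j = false) //;
  apply: contraNF fij => /eqP->.
Qed.

End DetFibers.

(** * Labellings that encode a set R together with a B-partition *)

Section Expansion.
Variables (F : fieldType) (n : nat) (A : 'M[F]_n).
Variables (k : nat) (B : 'I_k -> digraph 'I_n).
Hypothesis B_inj : injective B.
Hypothesis B_blocks : forall H : digraph 'I_n,
  H \in blocks (digraph_of A) <-> exists i : 'I_k, B i = H.

Local Notation G := (digraph_of A).
Local Notation C := (cut_vertices G).
Local Notation charM := (map_mx polyC A - 'X%:M).

Lemma phi_principal_submx (U : {set 'I_n}) :
  phi (principal_submx A U) = \det (submx_on charM U).
Proof.
congr (\det _); apply/matrixP=> i j.
by rewrite !mxE (inj_eq enum_val_inj).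
Qed.

Definition cut_weight v : {poly F} :=
  ('X - (A v v)%:P) * ((cut_index G v)%:R - 1).

(* [f v = None] encodes v \in R and [f v = Some i] encodes v \in U_i. *)
Definition admissible v (x : option 'I_k) : bool :=
  if x is Some i then v \in verts (B i) else v \in C.

(** Block diagonal up to reordering: a diagonal block of cut weights on R, and a principal block of
    [charM] on each U_i. Its determinant is thus one summand of the expansion. *)
Definition label_mx (f : {ffun 'I_n -> option 'I_k}) : 'M[{poly F}]_n :=
  \matrix_(i, j) if f i == f j
    then if f i == None then (i == j)%:R * cut_weight i else charM i j
    else 0.

Lemma det_label_mx (f : {ffun 'I_n -> option 'I_k}) :
  \det (label_mx f) = L_term A [set v | f v == None]
    * \prod_(i < k) phi (principal_submx A [set v | f v == Some i]).
Proof.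
pose M : 'M[{poly F}]_n := \matrix_(i, j)
  if f i == None then (i == j)%:R * cut_weight i else charM i j.
have -> : label_mx f = \matrix_(i, j) if f i == f j then M i j else 0.
  by apply/matrixP=> i j; rewrite !mxE.
rewrite -det_fibers big_option; congr (_ * _).
  rewrite det_trig; last first.
    apply/is_trig_mxP=> i j ij; rewrite !mxE (inj_eq enum_val_inj).
    have := enum_valP i; rewrite inE => ->.
    by rewrite (_ : i == j = false) ?mul0r //; apply: contraTF ij => /eqP->;
      rewrite ltnn.
  rewrite /L_term [RHS]big_enum_val; apply: eq_bigr => i _.
  by rewrite !mxE eqxx mul1r; have := enum_valP i; rewrite inE => ->.
apply: eq_bigr => i _; rewrite phi_principal_submx; congr (\det _).
apply/matrixP=> a b; rewrite !mxE.
by have := enum_valP a; rewrite inE => /eqP->.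
Qed.

(** Pairs of a set R of cut-vertices and a B-partition outside R correspond bijectively to
    admissible labellings. *)
Lemma sum_label_mx :
  \sum_(W : {set 'I_n} | W \subset C) L_term A W * S_term A B W =
  \sum_(f : {ffun 'I_n -> option 'I_k} | [forall v, admissible v (f v)])
    \det (label_mx f).
Proof.
under eq_bigr do rewrite /S_term mulr_sumr.
rewrite pair_big_dep /=.
pose h (f : {ffun 'I_n -> option 'I_k}) :
    {set 'I_n} * {ffun 'I_k -> {set 'I_n}} :=
  ([set v | f v == None], [ffun i => [set v | f v == Some i]]).
pose h' (p : {set 'I_n} * {ffun 'I_k -> {set 'I_n}}) :
    {ffun 'I_n -> option 'I_k} :=
  [ffun v => [pick i | v \in p.2 i]].
rewrite (reindex_onto h h') /=; last first.
  case=> W U /= /andP[_ /and3P[/forallP disU /eqP covU /forallP subU]].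
  (* Disjointness makes the index picked by [h'] unique; covering, used below, makes [None] occur
     exactly on [W]. *)
  have inU i v : v \in U i -> [pick j | v \in U j] = Some i.
    move=> vi; case: pickP => [j vj|/(_ i)]; last by rewrite vi.
    congr Some; apply/eqP; apply: contraT => ji.
    have /forallP/(_ i)/implyP/(_ ji)/pred0P/(_ v) := disU j.
    by rewrite /= vi vj.
  congr (_, _).
    apply/setP=> v; rewrite inE ffunE /=; case: pickP => [i vi|noU].
      by have /subsetP/(_ v vi) := subU i; rewrite inE => /andP[/negPf->].
    rewrite eqxx; apply/esym; apply: contraT => vW.
    have : v \in \bigcup_i U i by rewrite covU !inE vW.
    by case/bigcupP=> i _; rewrite noU.
  apply/ffunP=> i; rewrite ffunE; apply/setP=> v; rewrite inE ffunE /=.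
  apply/eqP/idP => [|/inU//]; case: pickP => // j vj [<-] //.
apply: eq_big => [f|f _]; last first.
  rewrite det_label_mx; congr (_ * _); apply: eq_bigr => i _.
  by rewrite ffunE.
have -> : h' (h f) == f.
  apply/eqP/ffunP=> v; rewrite ffunE /=.
  case: pickP => [i|nof]; first by rewrite ffunE inE => /eqP.
  by case fv: (f v) (nof) => [i|//] /(_ i); rewrite ffunE inE fv eqxx.
rewrite andbT; apply/andP/forallP =>
  [[/subsetP subC /and3P[_ _ /forallP subU]] v|adm].
  rewrite /admissible; case fv: (f v) => [i|];
    last by apply: subC; rewrite inE fv.
  have /subsetP/(_ v) := subU i; rewrite ffunE !inE fv => /(_ (eqxx _)).
  by case/andP.
split.
  by apply/subsetP=> v; rewrite inE => /eqP fv; have := adm v; rewrite fv.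
apply/and3P; split.
- apply/forallP=> i; apply/forallP=> j; apply/implyP=> ij.
  apply/pred0P=> v /=; rewrite !ffunE !inE; apply/negP=> /andP[/eqP-> /eqP[ji]].
  by rewrite ji eqxx in ij.
- apply/eqP/setP=> v; rewrite !inE andbT; apply/bigcupP/idP => [[i _]|].
    by rewrite ffunE inE => /eqP->.
  by case fv: (f v) => [i|//] _; exists i => //; rewrite ffunE inE fv.
apply/forallP=> i; apply/subsetP=> v; rewrite ffunE !inE => /eqP fv.
by have := adm v; rewrite fv.
Qed.

(** * Summing over labellings for a fixed permutation *)

Lemma B_block i : B i \in blocks G.
Proof. by apply/B_blocks; exists i. Qed.

Lemma cut_index_card v : cut_index G v = #|[set i | v \in verts (B i)]|.
Proof.
rewrite -(card_imset _ B_inj); apply: eq_card => H; rewrite inE.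
apply/andP/imsetP => [[/B_blocks[i <-] vB]|[j]].
  by exists i; rewrite ?inE.
by rewrite inE => vB ->; rewrite B_block.
Qed.

(** With d the cut-index, (λ - α)(d - 1) + d(α - λ) = α - λ; off the cut-vertices d = 1 and the
    first term is absent. *)
Lemma charM_fixed v :
  charM v v = (if v \in C then cut_weight v else 0)
    + \sum_(i < k | v \in verts (B i)) charM v v.
Proof.
rewrite sumr_const -(cardsE (fun i => v \in verts (B i))) -cut_index_card !mxE
  eqxx mulr1n.
case: ifPn => [_|]; last first.
  by rewrite inE => ncut; rewrite cut_index_noncut ?inE // add0r.
rewrite -mulr_natr /cut_weight -(opprB 'X) mulNr mulrBr mulr1.
by rewrite addrAC subrr add0r.
Qed.

(** On moved vertices the label is forced to be the block containing the orbit, while labels of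
    fixed points vary independently, so the sum factors over the vertices. *)
Lemma sum_label_perm (s : 'S_n) :
  \sum_(f : {ffun 'I_n -> option 'I_k} | [forall v, admissible v (f v)])
    \prod_v label_mx f v (s v) = \prod_v charM v (s v).
Proof.
(* A moved vertex with zero entry annihilates both sides. Otherwise [s] moves vertices only along
   edges, so each orbit lies in a block. *)
have [/existsP[v /andP[sv /eqP Av]]|noA] :=
    boolP [exists v, (s v != v) && (A v (s v) == 0)].
  have vs : v == s v = false by rewrite eq_sym (negPf sv).
  have M0 : charM v (s v) = 0 by rewrite !mxE vs Av mulr0n subr0.
  rewrite [RHS](bigD1 v) //= M0 mul0r big1 // => f _.
  rewrite (bigD1 v) //= mxE vs mul0r M0.
  by do 2?[case: ifP => _]; rewrite mul0r.
have es v : s v != v -> adj G v (s v).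
  move=> sv; move: noA; rewrite negb_exists => /forallP/(_ v).
  by rewrite sv /= => Av; rewrite /adj inE /= Av.
pose ob v := [pick i | porbit s v \subset verts (B i)].
have obP v : exists2 i, ob v = Some i & porbit s v \subset verts (B i).
  rewrite /ob; case: pickP => [i|nob]; first by exists i.
  have [|H /B_blocks[i <-]] :=
    nonsep_sub_block _ (nonsep_porbit (@adj_sym _ G) v es).
    exact/subsetP.
  by rewrite nob.
have ob_s v : ob (s v) = ob v.
  by have := porbit_perm s 1 v; rewrite expg1 /ob => ->.
have s_porbit v : s v \in porbit s v by rewrite -[s]expg1 mem_porbit.
(* This condition involves one vertex at a time, unlike the equality of [f v] and [f (s v)] tested
   in [label_mx]; that is what permits factoring. *)
pose good v x := if s v == v then admissible v x else x == ob v.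
pose w v x : {poly F} := if good v x then
  (if (s v == v) && (x == None) then cut_weight v else charM v (s v)) else 0.
transitivity (\sum_(f : {ffun 'I_n -> option 'I_k}) \prod_v w v (f v)).
  rewrite big_mkcond; apply: eq_bigr => f _.
  have [/forallP allg|] := boolP [forall v, good v (f v)].
    rewrite (_ : [forall v, admissible v (f v)]); last first.
      apply/forallP=> v; have := allg v; rewrite /good;
        case: ifP => // _ /eqP->.
      by have [i -> /subsetP] := obP v; apply; apply: porbit_id.
    apply: eq_bigr => v _; have gv := allg v; rewrite /w gv mxE.
    move: gv; rewrite /good; case: eqVneq => [->|sv /eqP fv].
      by rewrite !eqxx mul1r.
    have := allg (s v); rewrite /good (inj_eq perm_inj) (negPf sv) ob_s =>
      /eqP->.
    by rewrite fv eqxx; have [i ->] := obP v.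
  (* A labelling that is bad at [v] contributes zero. If [v] and [s v] carried the same block label,
     that block would share two vertices with the block of the orbit and equal it. *)
  rewrite negb_forall => /existsP[v bad].
  rewrite [RHS](bigD1 v) //= {1}/w (negPf bad) mul0r.
  case: ifP => // /forallP adm; rewrite (bigD1 v) //= mxE.
  move: bad; rewrite /good; case: eqVneq => [_|sv fv]; first by rewrite adm.
  have [/esym fs|_] := eqVneq; last by rewrite mul0r.
  case fvi: (f v) => [i|] /=; last by rewrite !mul0r.
  have [j obj /subsetP sub] := obP v.
  have := adm v; have := adm (s v); rewrite fs fvi /= => svi vi.
  have ij : i = j.
    apply: B_inj; apply: (block_eq_of_share2 (B_block i) (B_block j) sv) => //.
      exact: sub.
    exact/sub/porbit_id.
  by rewrite fvi obj ij eqxx in fv.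
(* The sum over labellings of products becomes a product over vertices of sums over labels. *)
rewrite -(bigA_distr_bigA w); apply: eq_bigr => v _.
rewrite /w /good; case: eqVneq => [->|sv]; last first.
  rewrite (bigD1 (ob v)) //= eqxx big1 ?addr0 // => x /negPf-> //.
rewrite big_option /= [RHS]charM_fixed; congr (_ + _).
by rewrite [RHS]big_mkcond.
Qed.

(** Exchanging the sum over labellings with the Leibniz sum reduces the claim to each permutation
    separately. *)
Lemma phi_expansion :
  phi A =
  \sum_(0 <= q < #|C|.+1)
    \sum_(W : {set 'I_n} | (W \subset C) && (#|W| == q))
      L_term A W * S_term A B W.
Proof.
rewrite big_mkord.
transitivity (\sum_(W : {set 'I_n} | W \subset C) L_term A W * S_term A B W).
  rewrite sum_label_mx /phi /determinant exchange_big /=.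
  by apply: eq_bigr => s _; rewrite -mulr_sumr sum_label_perm.
(* [inord] never falls back to its default here, as a subset of [C] has at most [#|C|] elements. *)
rewrite (partition_big (fun W : {set 'I_n} => inord #|W| : 'I_#|C|.+1)
  predT) //=.
apply: eq_bigr => q _; apply: eq_bigl => W; apply: andb_id2l => sWC.
by rewrite -val_eqE /= inordK // ltnS subset_leq_card.
Qed.

End Expansion.

Theorem theorem2 (R : realType) (n : nat) (A : 'M[R[i]]_n)
    (k : nat) (B : 'I_k -> digraph 'I_n)
    (B_inj : injective B)
    (B_blocks : forall H : digraph 'I_n,
       H \in blocks (digraph_of A) <-> exists i : 'I_k, B i = H) :
  phi A =
  \sum_(0 <= q < #|cut_vertices (digraph_of A)|.+1)
    \sum_(W : {set 'I_n} | (W \subset cut_vertices (digraph_of A))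
                           && (#|W| == q))
      L_term A W * S_term A B W.
Proof. exact: phi_expansion. Qed.
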